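(* Let $K$ be an algebraically closed field of characteristic zero, let $n\ge 3$, let $R=K[x_1,\dots,x_n]$ and let $S=K[X_1,\dots,X_n]$ be the divided power algebra, viewed as an $R$-module via contraction. Let $1\le r\le n-1$, let $a_1,\dots,a_n\ge 0$ and $b_1,\dots,b_n\ge 1$ be integers with $\sum_{i=1}^r b_i=\sum_{j=r+1}^n b_j>0$, and consider the binomial $$F=X_1^{a_1}X_2^{a_2}\cdots X_n^{a_n}\left(X_1^{b_1}X_2^{b_2}\cdots X_r^{b_r}-X_{r+1}^{b_{r+1}}\cdots X_n^{b_n}\right)\in S.$$ Then $A_F=R/\operatorname{Ann}_R(F)$ is a complete intersection if and only if, after changing coordinates (relabeling the variables and, if necessary, interchanging the roles of the two monomial factors, i.e. replacing $F$ by $-F$, which does not change $\operatorname{Ann}_R(F)$), we have $r=n-1$ and there exists an integer $1\le i\le n-1$ such that $a_i<q\,b_i$, where $q=\left\lfloor \frac{a_n+1}{b_n}\right\rfloor$. Moreover, in this case, setting $m=\min\left\{\left\lfloor \frac{a_j}{b_j}\right\rfloor \mid 1\le j\le n-1\right\}+1$, we have $$\operatorname{Ann}_R(F)=\left(x_1^{a_1+b_1+1},x_2^{a_2+b_2+1},\dots,x_{n-1}^{a_{n-1}+b_{n-1}+1},\,G\right),\qquad G=x_n^{a_n+1}+\sum_{j=1}^m\left(x_1^{b_1}\cdots x_{n-1}^{b_{n-1}}\right)^{j}x_n^{a_n+1-jb_n}.$$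
   Context: The divided power algebra $S=K[X_1,\dots,X_n]$ is an $R$-module via the contraction action $x_i\circ X_j^k=\delta_{ij}X_j^{k-1}$ if $k>0$ and $0$ otherwise (extended multiplicatively and linearly), with $\deg X_i=\deg x_i=1$. For a homogeneous $F\in S$, $\operatorname{Ann}_R(F)=\{f\in R\mid f\circ F=0\}$, and $A_F=R/\operatorname{Ann}_R(F)$ is the associated Artinian Gorenstein graded $K$-algebra ($F$ is its Macaulay dual generator). $A_F$ is a complete intersection if $\operatorname{Ann}_R(F)$ is generated by a regular sequence (equivalently, by $n$ elements). *)

(* Defs.v *)
From HB Require Import structures.
From mathcomp Require Import all_boot all_order all_algebra.
From mathcomp Require Import mpoly.
Set Implicit Arguments. Unset Strict Implicit. Unset Printing Implicit Defensive.
Import Order.TTheory GRing.Theory.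
Local Open Scope ring_scope.

(* Variables are indexed 0,...,n-1 (paper: 1,...,n).  Exponent data
   a, b are given as functions nat -> nat; only values below n matter. *)

(* Both R = K[x_1..x_n] and the divided power algebra S = K[X_1..X_n]
   are represented by {mpoly K[n]}.  For S, the monomial 'X_[m] stands for
   the divided-power basis element X^[m] (the paper's notation X^m), and the
   contraction action is x^alpha o X^beta = X^(beta - alpha) if alpha <= beta,
   0 otherwise, extended bilinearly. *)
Definition contract (K : comNzRingType) (n : nat) (f F : {mpoly K[n]}) : {mpoly K[n]} :=
  \sum_(m <- msupp f) \sum_(m' <- msupp F | (m <= m')%MM)
     (f@_m * F@_m') *: 'X_[(m' - m)%MM].

Definition in_ideal (K : comNzRingType) (n k : nat) (g : 'I_k -> {mpoly K[n]})
  (f : {mpoly K[n]}) : Prop :=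
  exists c : 'I_k -> {mpoly K[n]}, f = \sum_(i < k) c i * g i.

Definition ann_generated_by (K : comNzRingType) (n k : nat)
  (g : 'I_k -> {mpoly K[n]}) (F : {mpoly K[n]}) : Prop :=
  forall f : {mpoly K[n]}, contract f F = 0 <-> in_ideal g f.

Definition is_CI (K : comNzRingType) (n : nat) (F : {mpoly K[n]}) : Prop :=
  exists g : 'I_n -> {mpoly K[n]}, ann_generated_by g F.

Definition binomF (K : comNzRingType) (n : nat) (a b : nat -> nat) (r : nat)
  : {mpoly K[n]} :=
  'X_[[multinom (if (i < r)%N then (a i + b i)%N else a i) | i < n]]
  - 'X_[[multinom (if (i < r)%N then a i else (a i + b i)%N) | i < n]].

(* The condition of the theorem, with "after changing coordinates" unfolded:
   one of the two monomial blocks must consist of a single variable X_k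
   (k = n-1 when r = n-1, or k = 0 when r = 1, after swapping the factors),
   and some other index i satisfies a_i < q b_i, q = floor((a_k+1)/b_k). *)
Definition CI_condition (n : nat) (a b : nat -> nat) (r : nat) : Prop :=
  (r = n.-1 /\ exists i, (i < n.-1)%N /\ (a i < ((a n.-1).+1 %/ b n.-1) * b i)%N)
  \/ (r = 1%N /\ exists i, (0 < i < n)%N /\ (a i < ((a 0%N).+1 %/ b 0%N) * b i)%N).

(* m = min { floor(a_j / b_j) | j < n-1 } + 1.  The start value
   \sum_(j < n) a j is an upper bound of every a_j %/ b_j, so (for n >= 2)
   this is exactly the minimum. *)
Definition mmin (n : nat) (a b : nat -> nat) : nat :=
  (\big[minn/ (\sum_(j < n) a j)%N]_(j < n | (j < n.-1)%N) (a j %/ b j)%N).+1.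

Definition Gpoly (K : comNzRingType) (n : nat) (a b : nat -> nat) : {mpoly K[n]} :=
  \sum_(j < (mmin n a b).+1)
    'X_[[multinom (if i == n.-1 :> nat then ((a i).+1 - j * b i)%N else (j * b i)%N)
         | i < n]].

Definition ann_gens (K : comNzRingType) (n : nat) (a b : nat -> nat) (i : 'I_n)
  : {mpoly K[n]} :=
  if (i < n.-1)%N then 'X_i ^+ (a i + b i).+1 else Gpoly K n a b.

(* Main.v *)
(* With the functional L(f) = f@_al - f@_be for F = X^al - X^be, the annihilator
   of F is the largest ideal contained in the kernel of L.  Put c = al - be.  For f
   in this ideal, the coefficients at m and m - c agree when m <= al, and such a
   coefficient vanishes when m - c has a negative exponent; so the ideal is spanned
   by monomials and by sums over complete chains m, m - c, m - 2c, ...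

   Suppose one block is a single variable x_k.  The polynomial G is such a chain
   sum, with leading term x_k^(a_k+1); modulo G and the pure powers of the other
   variables every polynomial reduces to monomials below al, and following chains
   shows that no nonzero combination of those annihilates F.

   In the other cases an ideal I with n generators is excluded by exhibiting more
   than n elements of I independent modulo the irrelevant ideal times I.  For two
   blocks of size at least 2 these are all x_i^(a_i+b_i+1) and one
   x_p^(a_p+1) x_q^(a_q+1) with p, q in different blocks.  For a single-variable
   block {k} with q b_i <= a_i for all i <> k, q = floor((a_k+1)/b_k), they are the
   x_i^(a_i+b_i+1) and x_i^(a_i+1-q b_i) times the chain sum starting at
   x_k^(a_k+1), for i <> k: that is 2(n-1) > n elements. *)

Require Import Defs.
From HB Require Import structures.
From mathcomp Require Import all_boot all_order all_algebra.
From mathcomp Require Import mpoly zify.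
Import GRing.Theory.
Local Open Scope ring_scope.

(** * Annihilation of a binomial as identities between coefficients *)

Section Pairing.
Context {K : comNzRingType} {n : nat}.
Implicit Types (f p h : {mpoly K[n]}) (m d al be : 'X_{1..n}).

(* The coefficient of X^d in the contraction of X^al by f is the coefficient of
   X^al in the product X^d f. *)
Definition annihilates al be f : Prop :=
  forall d, ('X_[d] * f)@_al = ('X_[d] * f)@_be.

Lemma mcoeffXM m p d : ('X_[m] * p)@_(d + m) = p@_d.
Proof. by rewrite mulrC addmC mcoeffMX. Qed.

Lemma mcoeffXM0 {m} p {d} (i : 'I_n) : (d i < m i)%N -> ('X_[m] * p)@_d = 0.
Proof.
move=> lt_dm; rewrite [p]mpolyE mulr_sumr raddf_sum big1_seq //= => m' _.
rewrite -scalerAr mcoeffZ -mpolyXD mcoeffX; case: eqP => [eq_d|_]; last by rewrite mulr0.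
by move: lt_dm; rewrite -eq_d mnmDE; lia.
Qed.

Lemma contractE f p d :
  (contract f p)@_d = \sum_(m <- msupp p) p@_m * ('X_[d] * f)@_m.
Proof.
rewrite /contract raddf_sum /=.
under eq_bigr => m' _ do rewrite raddf_sum /= big_mkcond /=.
rewrite exchange_big /=; apply: eq_bigr => m' _.
rewrite [in RHS](mpolyE f) mulr_sumr raddf_sum mulr_sumr /=; apply: eq_bigr => m _.
rewrite mcoeffZ -scalerAr mcoeffZ -mpolyXD !mcoeffX [f@__ * _]mulrC -mulrA.
case: ifP => [le_m|/negbT nle_m].
  have -> : (d + m == m')%MM = (m' - m == d)%MM.
    by rewrite -[in LHS](submK le_m) eqm_add2r eq_sym.
  by [].
case: eqP => [eq_m'|_]; last by rewrite !(mul0r, mulr0).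
by move: nle_m; rewrite -eq_m' lem_addl.
Qed.

Lemma contract_binomialP al be f : al != be ->
  contract f ('X_[al] - 'X_[be]) = 0 <-> annihilates al be f.
Proof.
move=> ne_ab.
have supp : perm_eq (msupp ('X_[al] - 'X_[be] : {mpoly K[n]})) [:: al; be].
  apply: (perm_trans (msuppD _)) => [m /=|].
    rewrite (perm_mem (msuppN _)) !msuppX !inE.
    by case: eqP => // ->; apply: negbTE.
  by rewrite msuppX; apply: (perm_cat (perm_refl [:: al])); rewrite -(msuppX K be) msuppN.
have coefE d : (contract f ('X_[al] - 'X_[be]))@_d
             = ('X_[d] * f)@_al - ('X_[d] * f)@_be.
  rewrite contractE (perm_big _ supp) /= !big_cons big_nil !mcoeffB !mcoeffX !eqxx.
  rewrite (negbTE ne_ab) eq_sym (negbTE ne_ab) subr0 sub0r.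
  by rewrite mul1r mulN1r addr0.
split=> [f0 d|fann]; first by apply/eqP; rewrite -subr_eq0 -coefE f0 mcoeff0.
by apply/mpolyP => d; rewrite coefE fann subrr mcoeff0.
Qed.

Lemma annihilatesC {al be f} : annihilates al be f -> annihilates be al f.
Proof. by move=> fann d; rewrite fann. Qed.

Lemma annihilates_mul {al be f} p : annihilates al be f -> annihilates al be (p * f).
Proof.
move=> fann d; rewrite mulrCA [p]mpolyE !mulr_suml !raddf_sum /=.
by apply: eq_bigr => m _; rewrite -!scalerAl !mcoeffZ mulrA -mpolyXD fann.
Qed.

Lemma annihilates_sub {al be f p} :
  annihilates al be f -> annihilates al be p -> annihilates al be (f - p).
Proof. by move=> fann pann d; rewrite mulrBr !mcoeffB fann pann. Qed.

Lemma annihilates_sum {al be} {I : finType} (F : I -> {mpoly K[n]}) :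
  (forall i, annihilates al be (F i)) -> annihilates al be (\sum_i F i).
Proof.
move=> Fann d; rewrite mulr_sumr !raddf_sum /=; apply: eq_bigr => i _; exact: Fann.
Qed.

Lemma annihilates_link {al be f} d m m' : annihilates al be f ->
  (m + d)%MM = al -> (m' + d)%MM = be -> f@_m = f@_m'.
Proof.
by move=> fann eq_al eq_be; have := fann d; rewrite -eq_al -eq_be !mcoeffXM.
Qed.

(** The partner of [m] would be [be - d], which has a negative exponent at [i]. *)
Lemma annihilates_end {al be f} d m (i : 'I_n) : annihilates al be f ->
  (m + d)%MM = al -> (be i < d i)%N -> f@_m = 0.
Proof.
move=> fann eq_al lt_be.
by have := fann d; rewrite -eq_al mcoeffXM (mcoeffXM0 f i lt_be).
Qed.

Lemma annihilates_monomial {al be m} (i j : 'I_n) :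
  (al i < m i)%N -> (be j < m j)%N -> annihilates al be 'X_[m].
Proof.
move=> lt_al lt_be d; rewrite [_ * _]mulrC.
by rewrite (mcoeffXM0 _ i lt_al) (mcoeffXM0 _ j lt_be).
Qed.

End Pairing.

(** * Finitely generated ideals and a bound on the number of generators *)

Section IdealMembership.
Context {K : comNzRingType} {n k : nat} (g : 'I_k -> {mpoly K[n]}).

Lemma in_ideal_gen i : in_ideal g (g i).
Proof.
exists (fun j => (j == i)%:R); rewrite (bigD1 i) //= eqxx mul1r big1 ?addr0 //.
by move=> j /negbTE ->; rewrite mul0r.
Qed.

Lemma in_ideal_mul p f : in_ideal g f -> in_ideal g (p * f).
Proof.
case=> c ->; exists (fun i => p * c i).
by rewrite mulr_sumr; apply: eq_bigr => i _; rewrite mulrA.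
Qed.

Lemma in_ideal_add f1 f2 : in_ideal g f1 -> in_ideal g f2 -> in_ideal g (f1 + f2).
Proof.
case=> c1 -> [c2 ->]; exists (fun i => c1 i + c2 i).
by rewrite -big_split; apply: eq_bigr => i _; rewrite mulrDl.
Qed.

Lemma in_ideal0 : in_ideal g 0.
Proof. by exists (fun=> 0); rewrite big1 // => i _; rewrite mul0r. Qed.

Lemma in_ideal_sum (I : Type) (r : seq I) (P : pred I) F :
  (forall i, P i -> in_ideal g (F i)) -> in_ideal g (\sum_(i <- r | P i) F i).
Proof. by move=> Fg; apply: big_ind => //; [exact: in_ideal0 | exact: in_ideal_add]. Qed.

End IdealMembership.

(* The coefficients at [mu t] are functionals on I / mI, where m is the
   irrelevant ideal, and the [h t] form a dual family. *)
Lemma generators_lower_bound (K : fieldType) (n k : nat) (g : 'I_k -> {mpoly K[n]})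
    (T : finType) (h : T -> {mpoly K[n]})
    (mu : T -> 'X_{1..n}) :
  (forall t, in_ideal g (h t)) ->
  (forall t t', (h t)@_(mu t') = (t == t')%:R) ->
  (forall f l t, in_ideal g f -> ('X_l * f)@_(mu t) = 0) ->
  (#|T| <= k)%N.
Proof.
move=> hg dual mu0.
(* Every nonconstant monomial of [p] is a multiple of a variable, so [mu0] kills its
   contribution. *)
have coefM p i t : (p * g i)@_(mu t) = p@_0%MM * (g i)@_(mu t).
  rewrite [in LHS](mpolyE p) [in RHS](mpolyE p) mulr_suml !raddf_sum mulr_suml /=.
  apply: eq_bigr => m _; rewrite -scalerAl !mcoeffZ -mulrA; congr (_ * _).
  rewrite mcoeffX; have [->|m_neq0] := eqVneq m 0%MM; first by rewrite mpolyX0 !mul1r.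
  have [l ml] : exists l, m l != 0%N.
    apply/existsP; apply: contraNT m_neq0; rewrite negb_exists => /forallP m0.
    by apply/eqP/mnmP => l; rewrite mnm0E; apply/eqP/negPn.
  rewrite mul0r -(submK (_ : U_(l) <= m)%MM) ?lep1mP // addmC mpolyXD -mulrA.
  by apply: mu0; apply: in_ideal_mul; apply: in_ideal_gen.
have [c hE] := fin_all_exists hg.
pose C := \matrix_(s < #|T|, i < k) (c (enum_val s) i)@_0%MM.
pose D := \matrix_(i < k, s < #|T|) (g i)@_(mu (enum_val s)).
have CD : C *m D = 1%:M.
  apply/matrixP => s t; rewrite !mxE -(inj_eq enum_val_inj) -dual hE raddf_sum /=.
  by apply: eq_bigr => i _; rewrite !mxE coefM.
by rewrite -(mxrank1 K #|T|) -CD (leq_trans (mxrankM_maxl _ _)) ?rank_leq_col.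
Qed.

(** * The two exponent vectors and the ends of chains *)

Section Chains.
Context {K : comNzRingType} {n : nat} (a b : 'I_n -> nat).
Implicit Types (P Q : pred 'I_n) (f : {mpoly K[n]}) (m : 'X_{1..n}).

(** Complementary predicates give the two monomials of the binomial, so both blocks are treated
    alike. *)
Definition corner P : 'X_{1..n} :=
  [multinom (if P i then a i + b i else a i)%N | i < n].

(** The chain ends at [m]: subtracting [corner P - corner Q] would leave the negative exponent
    [m p - b p] at [p]. *)
Lemma mcoeff_isolated {P Q f m} (p : 'I_n) :
  annihilates (corner P) (corner Q) f -> (m <= corner P)%MM ->
  P p -> ~~ Q p -> (m p < b p)%N -> f@_m = 0.
Proof.
move=> fann le_m Pp /negbTE nQp lt_mp.
apply: (annihilates_end (corner P - m)%MM _ p fann); first by rewrite addmC submK.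
by rewrite mnmBE !mnmE Pp nQp; lia.
Qed.

Lemma annihilates_pure_power P Q (i : 'I_n) :
  annihilates (corner P) (corner Q) ('X_[U_(i) *+ (a i + b i).+1] : {mpoly K[n]}).
Proof.
by apply: (annihilates_monomial i i); rewrite mulmnE mnm1E eqxx !mnmE; case: ifP; lia.
Qed.

End Chains.

(** * Generators of the annihilator when one block is a single variable *)

Section SingleVariableBlock.
Context {K : comNzRingType} {n : nat} (a b : 'I_n -> nat) (k : 'I_n).
Hypothesis b_gt0 : forall i, (0 < b i)%N.
Implicit Types (f : {mpoly K[n]}) (m c : 'X_{1..n}).

Let top := corner a b (predC1 k).
Let bot := corner a b (pred1 k).

Definition chain_mnm (j : nat) : 'X_{1..n} :=
  [multinom (if i == k then (a i).+1 - j * b i else j * b i)%N | i < n].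

(* With P the product of the x_i^(b_i), i <> k, this is the sum of the
   P^j x_k^(a_k+1-j b_k);
   the subtraction is truncated unless s b_k <= a_k + 1. *)
Definition chain_sum (s : nat) : {mpoly K[n]} := \sum_(j < s.+1) 'X_[chain_mnm j].

(** Consecutive chain monomials differ by [top - bot]; the bound on [s] prevents truncation at
    [k]. *)
Lemma chain_mnm_link s j c : (s * b k <= (a k).+1)%N -> (j < s)%N ->
  ((c + chain_mnm j.+1)%MM == top) = ((c + chain_mnm j)%MM == bot).
Proof.
move=> le_s lt_js; have le_j : (b k + j * b k <= (a k).+1)%N.
  by rewrite -mulSn; apply: leq_trans le_s; rewrite leq_mul2r lt_js orbT.
apply/eqP/eqP => /mnmP eq_m; apply/mnmP => i; move: (eq_m i); rewrite !mnmE /= mulSn;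
  by case: (eqVneq i k) => [->|_] /=; lia.
Qed.

Lemma annihilates_chain_sum s c (i : 'I_n) : (s * b k <= (a k).+1)%N -> i != k ->
  (a i < c i + s * b i)%N -> annihilates top bot ('X_[c] * chain_sum s).
Proof.
move=> le_s /negbTE i_neq_k lt_ai d; rewrite mulrA -mpolyXD mulr_sumr !raddf_sum /=.
under eq_bigr => j _ do rewrite -mpolyXD mcoeffX.
under [RHS]eq_bigr => j _ do rewrite -mpolyXD mcoeffX.
(* After a shift by one the two sums match. The first term misses [top] since its exponent at [k]
   exceeds [a k]; the last misses [bot] by its exponent at [i]. *)
rewrite big_ord_recl big_ord_recr /= [X in X + _]mulrb [X in _ = _ + X]mulrb.
case: eqP => [/mnmP/(_ k)|_]; first by rewrite !mnmE /= eqxx /=; lia.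
case: eqP => [/mnmP/(_ i)|_]; first by rewrite !mnmE /= i_neq_k /=; lia.
rewrite add0r addr0; apply: eq_bigr => j _.
by rewrite /bump /= add1n (chain_mnm_link s) .
Qed.

(** Each step along the chain raises the exponent at [k] by [b k] and keeps the coefficient, until
    the chain ends or leaves the region below [top]; there the coefficient is 0. *)
Lemma annihilates_normal_eq0 f : annihilates top bot f ->
  (forall m, ~~ (m <= top)%MM -> f@_m = 0) -> f = 0.
Proof.
move=> fann normal; apply/mpolyP => m; rewrite mcoeff0.
have [N] := ubnP ((a k).+1 - m k)%N; elim: N m => // N IHN m lt_N.
have [le_m|/normal //] := boolP (m <= top)%MM.
have m_add : (m + (top - m))%MM = top by rewrite addmC submK.
have [le_d|] := boolP (top - m <= bot)%MM.
  rewrite (annihilates_link (top - m)%MM m (bot - (top - m))%MM fann) ?submK //.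
  apply: IHN; rewrite !mnmE /= eqxx /=.
  have /mnm_lepP/(_ k) := le_m; rewrite mnmE /= eqxx /=.
  by move: (b_gt0 k); lia.
rewrite negb_forall => /existsP[i]; rewrite -ltnNge => lt_i.
exact: (annihilates_end _ _ i fann m_add lt_i).
Qed.

Definition chain_gens (s : nat) (i : 'I_n) : {mpoly K[n]} :=
  if i != k then 'X_[U_(i) *+ (a i + b i).+1] else chain_sum s.

(** Division by the chain sum replaces x_k^(a_k+1) by terms of smaller exponent at [k], hence the
    induction on [m k]. *)
Lemma mnm_reduce s m : exists p : {mpoly K[n]},
  in_ideal (chain_gens s) ('X_[m] - p) /\ forall m', ~~ (m' <= top)%MM -> p@_m' = 0.
Proof.
have [N] := ubnP (m k); elim: N m => // N IHN m lt_N.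
have [le_m|] := boolP (m <= top)%MM.
  exists 'X_[m]; rewrite subrr; split=> [|m' nle_m']; first exact: in_ideal0.
  by rewrite mcoeffX; case: eqP => // eq_m; rewrite -eq_m le_m in nle_m'.
rewrite negb_forall => /existsP[i]; rewrite -ltnNge.
have [->|i_neq_k] := eqVneq i k; last first.
  rewrite mnmE /= i_neq_k => lt_i; exists 0; split=> [|m' _]; last by rewrite mcoeff0.
  have le_e : (U_(i) *+ (a i + b i).+1 <= m)%MM.
    by apply/mnm_lepP => l; rewrite mulmnE mnm1E; case: eqP => [<-|_]; lia.
  rewrite subr0 -(submK le_e) mpolyXD; apply: in_ideal_mul.
  by have := in_ideal_gen (chain_gens s) i; rewrite {2}/chain_gens i_neq_k.
rewrite mnmE /= eqxx /= => lt_k; pose c := (m - U_(k) *+ (a k).+1)%MM.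
have m0 : (c + chain_mnm 0)%MM = m.
  apply/mnmP => l; rewrite !mnmE mulmnE mnm1E eq_sym.
  by case: (eqVneq k l) => [<-|_]; lia.
have /fin_all_exists[p pP] (j : 'I_s) : exists p : {mpoly K[n]},
    in_ideal (chain_gens s) ('X_[c + chain_mnm j.+1] - p)
    /\ forall m', ~~ (m' <= top)%MM -> p@_m' = 0.
  apply: IHN; rewrite !mnmE eqxx mulmnE mnm1E eqxx mulSn.
  by move: (b_gt0 k); lia.
exists (- \sum_j p j); split=> [|m' nle_m']; last first.
  by rewrite mcoeffN raddf_sum big1 ?oppr0 // => j _; apply: (pP j).2.
have -> : 'X_[m] - - (\sum_j p j) =
    'X_[c] * chain_sum s + -1 * \sum_(j < s) ('X_[c + chain_mnm j.+1] - p j).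
  rewrite /chain_sum mulr_sumr big_ord_recl /= -mpolyXD m0 sumrB.
  under [X in _ + X + _]eq_bigr => j _ do rewrite -mpolyXD /bump add1n.
  by rewrite mulN1r opprK opprB addrACA subrr addr0.
apply: in_ideal_add; apply: in_ideal_mul.
  by have := in_ideal_gen (chain_gens s) k; rewrite {2}/chain_gens eqxx.
by apply: in_ideal_sum => j _; apply: (pP j).1.
Qed.

Lemma mpoly_reduce s f : exists p : {mpoly K[n]},
  in_ideal (chain_gens s) (f - p) /\ forall m', ~~ (m' <= top)%MM -> p@_m' = 0.
Proof.
elim/mpolyind: f => [|c m f _ _ [p [fp pn]]].
  by exists 0; rewrite subrr; split=> [|m' _]; rewrite ?mcoeff0 //; apply: in_ideal0.
have [q [mq qn]] := mnm_reduce s m; exists (c *: q + p); split=> [|m' nle_m'].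
  rewrite opprD addrACA -scalerBr -mul_mpolyC.
  by apply: in_ideal_add => //; apply: in_ideal_mul.
by rewrite mcoeffD mcoeffZ qn // pn // mulr0 addr0.
Qed.

(** The length [s] stays free, to serve for both floor((a_k+1)/b_k) and [mmin]. *)
Lemma annihilates_chain_gens s (i0 : 'I_n) f : i0 != k ->
  (a i0 < s * b i0)%N -> (s * b k <= (a k).+1)%N ->
  annihilates top bot f <-> in_ideal (chain_gens s) f.
Proof.
move=> i0_neq_k lt_i0 le_s.
have gens_ann g : in_ideal (chain_gens s) g -> annihilates top bot g.
  case=> c ->; apply: annihilates_sum => i; apply: annihilates_mul.
  rewrite /chain_gens; case: ifP => _; first exact: annihilates_pure_power.
  rewrite -[chain_sum s]mul1r -mpolyX0.
  by apply: (annihilates_chain_sum s 0%MM i0) => //; rewrite mnm0E.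
split=> [fann|]; last exact: gens_ann.
have [p [fp pn]] := mpoly_reduce s f.
suff p0 : p = 0 by move: fp; rewrite p0 subr0.
apply: annihilates_normal_eq0 pn.
have -> : p = f - (f - p) by rewrite opprB addrC subrK.
by apply: annihilates_sub => //; apply: gens_ann.
Qed.

End SingleVariableBlock.

(** * Lower bounds on the number of generators *)

Section LowerBounds.
Context {K : fieldType} {n : nat} (a b : 'I_n -> nat).
Hypothesis b_gt0 : forall i, (0 < b i)%N.

(** Dividing [mu t] by one of its variables leaves a monomial below one corner that misses some
    variable of the same block, so it is isolated. The second index in each block provides that
    variable. *)
Lemma two_block_generators (P Q : pred 'I_n) (p p' q q' : 'I_n) e
    (g : 'I_e -> {mpoly K[n]}) :
  (forall i, Q i = ~~ P i) -> P p -> P p' -> p != p' -> Q q -> Q q' -> q != q' ->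
  (forall f, annihilates (corner a b P) (corner a b Q) f <-> in_ideal g f) ->
  (n < e)%N.
Proof.
move=> QP Pp Pp' /negbTE pp' Qq Qq' /negbTE qq' gP.
have nQ i : P i -> ~~ Q i by rewrite QP negbK.
have nP i : Q i -> ~~ P i by rewrite QP.
have pq i j : P i -> Q j -> (i == j) = false.
  by move=> Pi /nP; apply: contraNF => /eqP <-.
pose mu (t : option 'I_n) : 'X_{1..n} :=
  if t is Some i then (U_(i) *+ (a i + b i).+1)%MM
  else (U_(p) *+ (a p).+1 + U_(q) *+ (a q).+1)%MM.
have mu_inj : injective mu.
  move=> [i|] [j|] //= /mnmP eq_mu.
  - move: (eq_mu i); rewrite !mulmnE !mnm1E eqxx.
    by case: (eqVneq j i) => [->//|_]; lia.
  - move: (eq_mu p) (eq_mu q); rewrite !mnmDE !mulmnE !mnm1E !eqxx [q == p]eq_sym (pq p q) //.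
    by case: (eqVneq i p) => [->|_]; rewrite ?(pq p q) //; lia.
  - move: (eq_mu p) (eq_mu q); rewrite !mnmDE !mulmnE !mnm1E !eqxx [q == p]eq_sym (pq p q) //.
    by case: (eqVneq j p) => [->|_]; rewrite ?(pq p q) //; lia.
suff : (#|{: option 'I_n}| <= e)%N by rewrite card_option card_ord.
apply: (generators_lower_bound K n e g _ (fun t => 'X_[mu t]) mu) => [t|t t'|f l t].
- apply/gP; case: t => [i|] /=; first exact: annihilates_pure_power.
  apply: (annihilates_monomial q p); rewrite !mnmE ?(negbTE (nP q Qq)) ?(negbTE (nQ p Pp));
    by rewrite !mulmnE !mnm1E !eqxx; lia.
- by rewrite mcoeffX (inj_eq mu_inj).
move/gP => fann; have fannC := annihilatesC fann.
case: t => [i|] /=.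
- have [->|l_neq_i] := eqVneq l i; last first.
    apply: (mcoeffXM0 _ l); rewrite mnm1E eqxx mulmnE mnm1E eq_sym (negbTE l_neq_i); lia.
  rewrite mulmSr mulrC addmC mcoeffMX.
  have [Pi|nPi] := boolP (P i).
    have [r [Pr /negbTE ri]] : exists r, P r /\ r != i.
      by have [<-|] := eqVneq p i; [exists p'; rewrite eq_sym pp' | exists p].
    apply: (mcoeff_isolated a b r fann) => //; last 2 first.
    + exact: nQ.
    + by rewrite mulmnE mnm1E eq_sym ri mul0n.
    apply/mnm_lepP => j; rewrite !mnmE mulmnE mnm1E.
    by case: eqP => [<-|_]; rewrite ?Pi; lia.
  have Qi : Q i by rewrite QP.
  have [r [Qr /negbTE ri]] : exists r, Q r /\ r != i.
    by have [<-|] := eqVneq q i; [exists q'; rewrite eq_sym qq' | exists q].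
  apply: (mcoeff_isolated a b r fannC) => //; last 2 first.
  + exact: nP.
  + by rewrite mulmnE mnm1E eq_sym ri mul0n.
  apply/mnm_lepP => j; rewrite !mnmE mulmnE mnm1E.
  by case: eqP => [<-|_]; rewrite ?Qi; lia.
(* Removing x_p from x_p^(a_p+1) x_q^(a_q+1) leaves a monomial below the corner of [Q]; removing x_q
   leaves one below that of [P]. *)
have [->|l_neq_p] := eqVneq l p.
  rewrite mulmSr -addmA [X in (_ + X)%MM]addmC addmA mulrC addmC mcoeffMX.
  apply: (mcoeff_isolated a b q' fannC) => //; last 2 first.
  + exact: nP.
  + by rewrite mnmDE !mulmnE !mnm1E (pq p q') // qq'.
  apply/mnm_lepP => j; rewrite !mnmE !mulmnE !mnm1E.
  case: (eqVneq p j) => [<-|_]; first by rewrite [q == p]eq_sym (pq p q) //; case: ifP; lia.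
  by case: (eqVneq q j) => [<-|_]; rewrite ?Qq; move: (b_gt0 q); lia.
have [->|l_neq_q] := eqVneq l q.
  rewrite [(U_(q) *+ _)%MM]mulmSr addmA mulrC addmC mcoeffMX.
  apply: (mcoeff_isolated a b p' fann) => //; last 2 first.
  + exact: nQ.
  + by rewrite mnmDE !mulmnE !mnm1E [q == p']eq_sym (pq p' q) // pp'.
  apply/mnm_lepP => j; rewrite !mnmE !mulmnE !mnm1E.
  case: (eqVneq p j) => [<-|_];
    first by rewrite [q == p]eq_sym (pq p q) // Pp; move: (b_gt0 p); lia.
  by case: (eqVneq q j) => [<-|_]; case: ifP; lia.
apply: (mcoeffXM0 _ l); rewrite mnm1E eqxx mnmDE !mulmnE !mnm1E.
by rewrite ![_ == l]eq_sym (negbTE l_neq_p) (negbTE l_neq_q).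
Qed.

Lemma single_block_generators (k : 'I_n) e (g : 'I_e -> {mpoly K[n]}) :
  (2 < n)%N ->
  (forall i, i != k -> ((a k).+1 %/ b k) * b i <= a i)%N ->
  (forall f, annihilates (corner a b (predC1 k)) (corner a b (pred1 k)) f
             <-> in_ideal g f) ->
  (n < e)%N.
Proof.
move=> n_gt2 le_a gP; set q := ((a k).+1 %/ b k)%N in le_a.
have le_qk : (q * b k <= (a k).+1)%N := leq_divM _ _.
have lt_qk : ((a k).+1 < q * b k + b k)%N by rewrite addnC -mulSn ltn_ceil.
(* A variable besides x_i and x_k separates chain terms from pure powers and isolates monomials. *)
have third i : exists r, (r != i) && (r != k).
  have : (0 < #|~: [set i; k]|)%N.
    by rewrite cardsCs setCK card_ord cards2; case: (i != k); lia.
  by case/card_gt0P => r; rewrite !inE negb_or; exists r.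
pose T := ({i : 'I_n | i != k} * bool)%type.
(* With this factor the last chain term has exponent [a i + 1] at [i], just above the second
   corner. *)
pose c i := (U_(i) *+ (a i - q * b i).+1)%MM : 'X_{1..n}.
pose h (t : T) : {mpoly K[n]} := let i := val t.1 in
  if t.2 then 'X_[U_(i) *+ (a i + b i).+1] else 'X_[c i] * chain_sum a b k q.
pose mu (t : T) : 'X_{1..n} := let i := val t.1 in
  if t.2 then (U_(i) *+ (a i + b i).+1)%MM else (c i + U_(k) *+ (a k).+1)%MM.
suff : (#|{: T}| <= e)%N.
  rewrite card_prod card_bool card_sig (eq_card (_ : _ =i predC1 k)) // cardC1 card_ord.
  lia.
apply: (generators_lower_bound K n e g _ h mu)
  => [[[i ik] s]|[[i ik] s] [[j jk] s']|f l [[i ik] s]].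
- apply/gP; rewrite /h /=; case: s; first exact: annihilates_pure_power.
  apply: (annihilates_chain_sum a b k q (c i) i) => //.
  by rewrite mulmnE mnm1E eqxx; have := le_a i ik; lia.
- rewrite /h /mu /chain_sum /= xpair_eqE -(inj_eq val_inj) /=.
  case: s; case: s' => /=; rewrite ?mulr_sumr ?raddf_sum ?mcoeffX ?andbT ?andbF /=.
  + congr ((_)%:R); congr nat_of_bool; apply/eqP/eqP => [/mnmP/(_ i)|->//].
    by rewrite !mulmnE !mnm1E eqxx; case: (eqVneq j i) => //; lia.
  + case: eqP => // /mnmP/(_ k); rewrite mnmDE !mulmnE !mnm1E eqxx (negbTE ik); lia.
  + apply: big1 => j' _; rewrite -mpolyXD mcoeffX.
    case: eqP => // /mnmP eq_m; exfalso.
    have [r /andP[rj rk]] := third j.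
    move: (eq_m k) (eq_m r); rewrite !mnmDE !mulmnE !mnm1E !mnmE eqxx (negbTE rk).
    rewrite [j == r]eq_sym (negbTE rj) (negbTE jk).
    case: (nat_of_ord j') => [|j'']; rewrite ?mulSn; last by move: (b_gt0 r); lia.
    by rewrite mul0n; lia.
  (* Only the head of the chain sum has exponent a_k+1 at [k]. *)
  rewrite big_ord_recl big1 => [|j' _]; last first.
    rewrite -mpolyXD mcoeffX; case: eqP => // /mnmP/(_ k).
    rewrite !mnmDE !mulmnE !mnm1E !mnmE eqxx (negbTE ik) (negbTE jk) lift0 mulSn.
    by move: (b_gt0 k); lia.
  rewrite addr0 -mpolyXD mcoeffX; congr ((_)%:R); congr nat_of_bool.
  apply/eqP/eqP => [/mnmP/(_ i)|->].
    rewrite !mnmDE !mulmnE !mnm1E !mnmE eqxx (negbTE ik) eq_sym.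
    rewrite [k == i]eq_sym (negbTE ik) mul0n.
    by case: (eqVneq i j) => //; lia.
  apply/mnmP => r; rewrite !mnmDE mnmE [(U_(k) *+ _)%MM _]mulmnE mnm1E eq_sym.
  by case: (eqVneq k r) => [<-|_] /=; lia.
move/gP => fann; have fannC := annihilatesC fann.
have [r /andP[/negbTE ri rk]] := third i.
rewrite /mu /=; case: s.
  have [->|l_neq_i] := eqVneq l i; last first.
    apply: (mcoeffXM0 _ l); rewrite mnm1E eqxx mulmnE mnm1E eq_sym (negbTE l_neq_i); lia.
  rewrite mulmSr mulrC addmC mcoeffMX.
  apply: (mcoeff_isolated a b r fann) => //=; last by rewrite mulmnE mnm1E eq_sym ri.
  apply/mnm_lepP => j; rewrite !mnmE mulmnE mnm1E /=.
  by case: (eqVneq i j) => [<-|_]; rewrite ?ik; lia.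
have [->|l_neq_k] := eqVneq l k.
  rewrite [(U_(k) *+ _)%MM]mulmSr addmA mulrC addmC mcoeffMX.
  apply: (mcoeff_isolated a b r fann) => //=; last first.
    by rewrite mnmDE !mulmnE !mnm1E [i == r]eq_sym ri [k == r]eq_sym (negbTE rk).
  apply/mnm_lepP => j; rewrite !mnmE !mulmnE !mnm1E /=.
  case: (eqVneq i j) => [<-|_];
    first by rewrite [k == i]eq_sym (negbTE ik) /=; move: (b_gt0 i); lia.
  by case: (eqVneq k j) => [<-|_]; rewrite ?eqxx /=; lia.
have [->|l_neq_i] := eqVneq l i; last first.
  apply: (mcoeffXM0 _ l); rewrite mnm1E eqxx mnmDE !mulmnE !mnm1E.
  by rewrite ![_ == l]eq_sym (negbTE l_neq_i) (negbTE l_neq_k).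
rewrite /c mulmSr -addmA [X in (_ + X)%MM]addmC addmA mulrC addmC mcoeffMX.
pose m (j : nat) := (U_(i) *+ (a i - q * b i) + chain_mnm a b k j)%MM.
have m0 : (U_(i) *+ (a i - q * b i) + U_(k) *+ (a k).+1)%MM = m 0%N.
  apply/mnmP => j; rewrite !mnmDE [chain_mnm _ _ _ _ _]mnmE [(U_(k) *+ _)%MM _]mulmnE mnm1E eq_sym.
  by case: (eqVneq k j) => [<-|_] /=; lia.
(* The chain of [m 0] runs through [m 1, ..., m q] and stops there because the
   next monomial would have a negative exponent at k. *)
have m_link j : (j < q)%N -> f@_(m j.+1) = f@_(m j).
  move=> lt_jq; have le_j : (b k + j * b k <= q * b k)%N.
    by rewrite -mulSn leq_mul2r lt_jq orbT.
  have le_top : (m j.+1 <= corner a b (predC1 k))%MM.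
    apply/mnm_lepP => s; rewrite !mnmE mulmnE mnm1E /= mulSn.
    case: (eqVneq s k) => [->|sk] /=; first by rewrite (negbTE ik); move: (b_gt0 k); lia.
    have le_s : (b s + j * b s <= q * b s)%N by rewrite -mulSn leq_mul2r lt_jq orbT.
    by have := le_a s sk; case: (eqVneq i s) => [->|_]; lia.
  pose d := (corner a b (predC1 k) - m j.+1)%MM.
  apply: (annihilates_link d _ _ fann); first by rewrite addmC submK.
  apply/eqP; rewrite [(m j + d)%MM]addmC /m addmA -(chain_mnm_link a b k q) //.
  by rewrite -addmA submK.
have mq : f@_(m q) = 0.
  apply: (mcoeff_isolated a b k fannC) => //=.
  - apply/mnm_lepP => s; rewrite !mnmE mulmnE mnm1E /=.
    case: (eqVneq s k) => [->|sk]; first by rewrite (negbTE ik); lia.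
    by have := le_a s sk; case: (eqVneq i s) => [->|_]; lia.
  - by rewrite negbK.
  - by rewrite mnmDE mulmnE mnm1E mnmE (negbTE ik) eqxx; lia.
rewrite m0 -mq; elim: {-2}q (leqnn q) => // j IHj lt_jq.
by rewrite m_link // IHj // ltnW.
Qed.

End LowerBounds.

(** Sufficiency takes the quotient as chain length; if no index qualifies, the lower bound excludes
    [n] generators. *)
Lemma single_block_CI (K : fieldType) (n : nat) (a b : 'I_n -> nat) (k : 'I_n) :
  (2 < n)%N -> (forall i, 0 < b i)%N ->
  (exists g : 'I_n -> {mpoly K[n]}, forall f,
     annihilates (corner a b (predC1 k)) (corner a b (pred1 k)) f <-> in_ideal g f)
  <-> exists i, i != k /\ (a i < ((a k).+1 %/ b k) * b i)%N.
Proof.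
move=> n_gt2 b_gt0; split=> [[g gP]|[i [ik lt_i]]]; last first.
  exists (chain_gens a b k ((a k).+1 %/ b k)) => f.
  exact: annihilates_chain_gens ik lt_i (leq_divM _ _).
have [/existsP[i /andP[ik lt_i]]|none] :=
  boolP [exists i, (i != k) && (a i < ((a k).+1 %/ b k) * b i)%N]; first by exists i.
suff : (n < n)%N by rewrite ltnn.
apply: (single_block_generators a b b_gt0 k n g n_gt2 _ gP) => i ik; rewrite leqNgt.
by apply: contra none => lt_i; apply/existsP; exists i; rewrite ik.
Qed.

(** * Transfer to the given binomial and to [mmin] *)

Section BinomialDual.
Variables (K : fieldType) (n : nat) (a b : nat -> nat).
Let a' (i : 'I_n) := a i.
Let b' (i : 'I_n) := b i.

Lemma ann_gensE (k : 'I_n) (i : 'I_n) : k = n.-1 :> nat ->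
  @ann_gens K n a b i = chain_gens a' b' k (mmin n a b) i.
Proof.
move=> kE; have neq_k (j : 'I_n) : (j == k) = (j == n.-1 :> nat).
  by rewrite -kE.
have lt_k (j : 'I_n) : (j < n.-1)%N = (j != k) by rewrite neq_k; case: j => j /=; lia.
rewrite /ann_gens /chain_gens lt_k; case: ifP => _; first by rewrite mpolyXn.
apply: eq_bigr => j _; congr 'X_[_]; apply/mnmP => l.
by rewrite !mnmE neq_k.
Qed.

Hypotheses (n_gt2 : (3 <= n)%N) (b_gt0 : forall i, (i < n)%N -> (1 <= b i)%N).

Lemma contract_binomF (r : nat) (P Q : pred 'I_n) (f : {mpoly K[n]}) :
  (forall i : 'I_n, P i = (i < r)%N) -> (forall i : 'I_n, Q i = ~~ (i < r)%N) ->
  contract f (binomF K n a b r) = 0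
  <-> annihilates (corner a' b' P) (corner a' b' Q) f.
Proof.
move=> PE QE.
have -> : binomF K n a b r = 'X_[corner a' b' P] - 'X_[corner a' b' Q].
  congr ('X_[_] - 'X_[_]); apply/mnmP => i; rewrite !mnmE ?PE ?QE //.
  by case: (i < r)%N.
apply: contract_binomialP; have n_gt0 : (0 < n)%N by apply: leq_trans n_gt2.
pose i0 := Ordinal n_gt0; apply/eqP => /mnmP/(_ i0); rewrite !mnmE PE QE.
by have : (0 < b' i0)%N := b_gt0 0 n_gt0; case: (i0 < r)%N => /=; lia.
Qed.

Lemma two_block_not_CI (r : nat) : (1 < r)%N -> (r < n.-1)%N ->
  ~ is_CI (binomF K n a b r).
Proof.
move=> r_gt1 r_lt [g gP].
(* Indices 0 and 1 lie in the first block since r > 1; n-1 and n-2 lie in the second since r <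
   n-1. *)
have [lt0 lt1] : (0 < n)%N /\ (1 < n)%N by lia.
have [lt2 lt3] : (n.-1 < n)%N /\ (n.-2 < n)%N by lia.
suff : (n < n)%N by rewrite ltnn.
apply: (two_block_generators a' b' _ (fun i => i < r)%N (fun i => ~~ (i < r))%N
          (Ordinal lt0) (Ordinal lt1) (Ordinal lt2) (Ordinal lt3) n g);
  rewrite ?neq_ltn //=; try lia.
- by move=> i; apply: b_gt0.
- by move=> f; rewrite -contract_binomF.
Qed.

Lemma single_block_is_CI (r : nat) (k : 'I_n) :
  (forall i : 'I_n, (i < r)%N = (i != k)) \/ (forall i : 'I_n, (i < r)%N = (i == k)) ->
  is_CI (binomF K n a b r)
  <-> exists i : 'I_n, i != k /\ (a i < ((a k).+1 %/ b k) * b i)%N.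
Proof.
move=> rE; rewrite -(single_block_CI K n a' b' k) //; last by move=> i; apply: b_gt0.
have E f : contract f (binomF K n a b r) = 0
    <-> annihilates (corner a' b' (predC1 k)) (corner a' b' (pred1 k)) f.
  case: rE => rE; first by apply: contract_binomF => i; rewrite rE //= negbK.
  rewrite (contract_binomF r (pred1 k) (predC1 k)) => [|i|i]; rewrite ?rE //.
  by split; apply: annihilatesC.
by split=> -[g gP]; exists g => f; rewrite -gP E.
Qed.

(** These bounds make [mmin] an admissible chain length: the first keeps it at most
    floor((a_k+1)/b_k), the second pushes the last term beyond the second corner. *)
Lemma mminP (i0 : nat) : (i0 < n.-1)%N ->
  (mmin n a b <= (a i0 %/ b i0).+1)%N /\
  exists i : 'I_n, (i < n.-1)%N /\ (a i < mmin n a b * b i)%N.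
Proof.
move=> lt_i0; have i0_lt : (i0 < n)%N by lia.
pose i1 := Ordinal i0_lt; split.
  by rewrite ltnS; apply: (@Order.TotalTheory.bigmin_le_cond _ nat _ _ i1).
case: (@arg_minnP _ i1 (fun i : 'I_n => i < n.-1)%N (fun i => a i %/ b i)%N lt_i0) => j lt_j min_j.
exists j; split=> //; rewrite -ltn_divLR ?b_gt0 // ltnS.
(* The start value of the minimum is at least [a j], so it does not undercut the least quotient. *)
apply: (big_ind (fun x => a j %/ b j <= x)%N) => [|x y le_x le_y|i]; last exact: min_j.
  by rewrite (bigD1 j) //= (leq_trans (leq_div _ _)) // leq_addr.
by rewrite leq_min le_x.
Qed.

End BinomialDual.

(** * Assembly of the criterion and the explicit generators *)

Theorem theorem3p3 (K : closedFieldType) (char0 : [pchar K] =i pred0)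
  (n : nat) (hn : (3 <= n)%N) (r : nat) (hr : (1 <= r <= n.-1)%N)
  (a b : nat -> nat) (hb : forall i, (i < n)%N -> (1 <= b i)%N)
  (hbal : (\sum_(i < n | (i < r)%N) b i = \sum_(i < n | (r <= i)%N) b i)%N)
  (hpos : (0 < \sum_(i < n | (i < r)%N) b i)%N) :
  (is_CI (@binomF K n a b r) <-> CI_condition n a b r)
  /\ (r = n.-1 ->
      (exists i, (i < n.-1)%N /\ (a i < ((a n.-1).+1 %/ b n.-1) * b i)%N) ->
      ann_generated_by (@ann_gens K n a b) (@binomF K n a b r)).
Proof.
have [lt_last lt_first] : (n.-1 < n)%N /\ (0 < n)%N by lia.
pose last := Ordinal lt_last; pose first := Ordinal lt_first.
have lastE (i : 'I_n) : (i < n.-1)%N = (i != last).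
  by rewrite -val_eqE /=; case: i => i /=; lia.
have firstE (i : 'I_n) : (i < 1)%N = (i == first) by rewrite -val_eqE /=; case: i => [[]].
split; last first.
  move=> -> [i0 [lt_i0 lt_ai0]] f.
  have [le_m [i [lt_i lt_ai]]] := mminP n a b hn hb i0 lt_i0.
  have b_i0 : (0 < b i0)%N by apply: hb; lia.
  (* From a_i0 < q b_i0 follows floor(a_i0/b_i0) < q, so [mmin] is at most q. *)
  have le_mb : (mmin n a b * b last <= (a last).+1)%N.
    apply: leq_trans (leq_divM (a last).+1 (b last)); rewrite leq_mul2r.
    by rewrite (leq_trans le_m) ?orbT // ltn_divLR.
  rewrite (contract_binomF K n a b hn hb n.-1 (predC1 last) (pred1 last)) => [|j|j].
  - rewrite (annihilates_chain_gens _ _ last _ (mmin n a b) i) // -?lastE //; last first.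
      by move=> j; apply: hb.
    by split=> -[c ->]; exists c; apply: eq_bigr => j _; rewrite (ann_gensE K n a b last).
  - by rewrite /= lastE.
  - by rewrite /= lastE negbK.
(* Three shapes: r = n-1 (last variable alone), 1 < r < n-1 (both blocks of size at least 2), r = 1
   (first variable alone). *)
have [r_lt|r_ge] := ltnP r n.-1; last first.
  have -> : r = n.-1 by lia.
  rewrite (single_block_is_CI K n a b hn hb n.-1 last); last by left.
  split=> [[i [ik lt_i]]|[[_ [i [ik lt_i]]]|[n2 _]]]; last by lia.
    by left; split=> //; exists i; rewrite lastE.
  have i_lt : (i < n)%N by lia.
  by exists (Ordinal i_lt); rewrite -lastE.
have [r_gt1|r_le1] := ltnP 1 r.
  split=> [|[[r1 _]|[r1 _]]]; [|lia|lia].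
  by move/(two_block_not_CI K n a b hn hb r r_gt1 r_lt).
have -> : r = 1%N by lia.
rewrite (single_block_is_CI K n a b hn hb 1 first); last by right.
split=> [[i [ik lt_i]]|[[n2 _]|[_ [i [/andP[i_gt0 i_lt] lt_i]]]]].
- right; split=> //; exists i; split=> //; rewrite ltn_ord andbT.
  by move: ik; rewrite -firstE; lia.
- by lia.
- by exists (Ordinal i_lt); split=> //; rewrite -firstE /=; lia.
Qed.
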